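(* Let $\mathcal L_0\subset\mathbb R^d$ be an $(r,R)$-Delone set and $N\ge1$. The topological space $\mathcal G_N$, with its inversion and composition maps, is an étale groupoid.
   Context: Fix $d\ge1$, $0<r<R$. $\mathcal L\subset\mathbb R^d$ (discrete, infinite) is $(r,R)$-Delone if each closed ball of radius $r$ contains at most one point and each closed ball of radius $R$ at least one point of $\mathcal L$; $\mathrm{Del}$ is the set of these, with the topology of the metric $D(\Lambda,\Lambda')=\inf\{1/(1+\rho):d_H(\Lambda[\rho],\Lambda'[\rho])<1/\rho\}$ on closed subsets of $\mathbb R^d$, where $\Lambda[\rho]=(\Lambda\cap B(0,\rho))\cup\partial B(0,\rho)$ and $d_H$ is the Hausdorff distance. The hull $\Omega_{\mathcal L_0}$ is the closure of $\{\mathcal L_0-a:a\in\mathbb R^d\}$ (all its points are Delone sets). $\widehat{\mathrm{Del}}^{(N)}$ is the set of triples $\xi=(\mathcal L_\xi,V_\xi,\chi_\xi)$ with $\mathcal L_\xi\in\mathrm{Del}$, $V_\xi\subset\mathcal L_\xi$, $|V_\xi|=N$, and $\chi_\xi:\{1,\dots,N\}\to V_\xi$ a bijection. A neighborhood base at $(\mathcal L,V,\chi)$ is given by the sets of all $(\mathcal L',V',g\circ\chi)$ with $d_H(\mathcal L[M],\mathcal L'[M])<\epsilon$, $V'\subset\mathcal L'$, $|V'|=N$, $d_H(V,V')<\epsilon$, $g:V\to V'$ the unique bijection with $|g(v)-v|<\epsilon$, for $0<\epsilon<r/2$ and $M$ large. $\widehat{\mathrm{Del}}^{(N,N)}=\{(\xi,\zeta)\in\widehat{\mathrm{Del}}^{(N)}\times\widehat{\mathrm{Del}}^{(N)}:\mathcal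 L_\xi=\mathcal L_\zeta\}$ with the relative product topology. For $x\in\mathbb R^d$, $\mathfrak t_x(y)=y-x$, $\hat{\mathfrak t}_x\xi=(\mathcal L_\xi-x,V_\xi-x,\mathfrak t_x\circ\chi_\xi)$ and $\hat{\mathfrak t}_x(\xi,\zeta)=(\hat{\mathfrak t}_x\xi,\hat{\mathfrak t}_x\zeta)$. $\mathcal G_N=\{(\xi,\zeta)\in\widehat{\mathrm{Del}}^{(N,N)}:\mathcal L_\xi=\mathcal L_\zeta\in\Omega_{\mathcal L_0},\ \chi_\xi(1)=0\}$ with the relative topology. Inversion: $(\xi,\zeta)^{-1}=\hat{\mathfrak t}_{\chi_\zeta(1)}(\zeta,\xi)$. Composable pairs: $((\xi,\zeta),(\xi',\zeta'))$ with $\xi'=\hat{\mathfrak t}_{\chi_\zeta(1)}\zeta$; composition: $(\xi,\zeta)\cdot\hat{\mathfrak t}_{\chi_\zeta(1)}(\zeta,\zeta')=(\xi,\zeta')$. Range and source: $\mathfrak r(\xi,\zeta)=(\xi,\xi)$, $\mathfrak s(\xi,\zeta)=\hat{\mathfrak t}_{\chi_\zeta(1)}(\zeta,\zeta)$; the unit space is identified with $\Xi^{(N)}_{\mathcal L_0}=\{\xi\in\widehat{\mathrm{Del}}^{(N)}:\mathcal L_\xi\in\Omega_{\mathcal L_0},\ \chi_\xi(1)=0\}$. A topological groupoid is a groupoid with a locally compact Hausdorff topology for which inversion, source, range and composition are continuous; it is étale if $\mathfrak r$ is a local homeomorphism onto the unit space.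
   Formalization: The marked sets range over all sets that are (r',R)-Delone for every r'<r (distances at least 2r), so that the whole hull is included; with closed balls of radius r the class is not closed under limits and G_N can fail to be locally compact. Both agree when the hull lies in Del. *)

(* Defs.v *)
From HB Require Import structures.
From mathcomp Require Import all_boot all_order all_algebra.
From mathcomp Require Import ring lra.
From mathcomp Require Import all_classical all_reals all_analysis.
Set Implicit Arguments.
Unset Strict Implicit.
Unset Printing Implicit Defensive.
Import Order.TTheory GRing.Theory Num.Theory.
Import numFieldNormedType.Exports.
Local Open Scope classical_set_scope.
Local Open Scope ring_scope.

Section euclidean.
Context {K : realType} {d : nat}.
Implicit Types (x y a : 'rV[K]_d.+1) (A B L : set 'rV[K]_d.+1) (r R rho : K).

(* The space is ['rV[K]_d.+1], of dimension [d.+1 >= 1].  Its library norm is the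
   sup norm, so the Euclidean norm has to be introduced separately; both norms
   induce the same topology. *)
Definition enorm x : K := Num.sqrt (\sum_i x 0 i ^+ 2).

Definition eball x rho : set 'rV[K]_d.+1 := [set y | enorm (y - x) <= rho].

Definition esphere x rho : set 'rV[K]_d.+1 := [set y | enorm (y - x) = rho].

Definition translate x y : 'rV[K]_d.+1 := y - x.

Definition hausdorff A B : \bar K :=
  maxe (ereal_sup [set ereal_inf [set (enorm (a - b))%:E | b in B] | a in A])
       (ereal_sup [set ereal_inf [set (enorm (a - b))%:E | a in A] | b in B]).

Definition trunc L rho : set 'rV[K]_d.+1 := (L `&` eball 0 rho) `|` esphere 0 rho.

(* A metric on closed sets; it is finite, as the set below contains every small
   enough [rho]. *)
Definition closed_dist A B : \bar K :=
  ereal_inf [set ((1 + rho)^-1)%:E | rho in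
    [set rho | 0 < rho /\
      (hausdorff (trunc A rho) (trunc B rho) < (rho^-1)%:E)%E]].

Definition is_delone r R L :=
  [/\ 0 < r < R,
      infinite_set L,
      L `<=` isolated L,
      forall c x y, (L `&` eball c r) x -> (L `&` eball c r) y -> x = y &
      forall c, L `&` eball c R !=set0].

(* If [L0] is [(r, R)]-Delone, then points of a limit of translates of [L0] can
   be at distance exactly [2 * r], hence lie in a common closed ball of radius
   [r]; a limit is only [(r', R)]-Delone for every [r' < r].  The sets below are
   all the sets with that property, so that they include the whole hull. *)
Definition is_delone_limit r R L :=
  0 < r < R /\ forall r', 0 < r' < r -> is_delone r' R L.

Definition hull L0 : set (set 'rV[K]_d.+1) :=
  [set L | closed L /\ forall e, 0 < e ->
     exists a, (closed_dist L (translate a @` L0) < e%:E)%E].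

End euclidean.

Section euclidean_facts.
Context {K : realType} {d : nat}.
Implicit Types (x y a : 'rV[K]_d.+1) (A B L : set 'rV[K]_d.+1) (r R rho : K).

Lemma enorm_ge0 x : 0 <= enorm x.
Proof. exact: sqrtr_ge0. Qed.

Lemma enorm_sqr x : enorm x ^+ 2 = \sum_i x 0 i ^+ 2.
Proof. by rewrite sqr_sqrtr// sumr_ge0// => i _; rewrite sqr_ge0. Qed.

Lemma enormN x : enorm (- x) = enorm x.
Proof. by congr Num.sqrt; apply: eq_bigr => i _; rewrite mxE sqrrN. Qed.

Lemma enormB x y : enorm (x - y) = enorm (y - x).
Proof. by rewrite -enormN opprB. Qed.

Lemma enormZ (t : K) x : enorm (t *: x) = `|t| * enorm x.
Proof.
rewrite /enorm -sqrtr_sqr -sqrtrM ?sqr_ge0// mulr_sumr.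
by congr Num.sqrt; apply: eq_bigr => i _; rewrite mxE exprMn.
Qed.

Lemma enorm_eq0 x : enorm x = 0 -> x = 0.
Proof.
move=> x0; apply/rowP => i; rewrite mxE.
have /eqP : \sum_i x 0 i ^+ 2 = 0 by rewrite -enorm_sqr x0 expr0n.
rewrite psumr_eq0; last by move=> j _; rewrite sqr_ge0.
by move=> /allP/(_ i); rewrite mem_index_enum sqrf_eq0 => /(_ isT)/eqP.
Qed.

Lemma enormD x y : enorm (x + y) <= enorm x + enorm y.
Proof.
have [->|x0] := eqVneq x 0; first by rewrite add0r lerDr enorm_ge0.
have [->|y0] := eqVneq y 0; first by rewrite addr0 lerDl enorm_ge0.
have xp : 0 < enorm x.
  by rewrite lt_neqAle enorm_ge0 eq_sym andbT; apply: contra_neq x0 => /enorm_eq0.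
have yp : 0 < enorm y.
  by rewrite lt_neqAle enorm_ge0 eq_sym andbT; apply: contra_neq y0 => /enorm_eq0.
have dotE (s t : K) : \sum_i (s * x 0 i + t * y 0 i) ^+ 2 =
    s ^+ 2 * enorm x ^+ 2 + t ^+ 2 * enorm y ^+ 2
    + 2 * s * t * \sum_i (x 0 i * y 0 i).
  rewrite !enorm_sqr !mulr_sumr -!big_split/=.
  by apply: eq_bigr => i _; ring.
have CS : \sum_i (x 0 i * y 0 i) <= enorm x * enorm y.
  have : 0 <= \sum_i (enorm y * x 0 i + (- enorm x) * y 0 i) ^+ 2.
    by apply: sumr_ge0 => i _; rewrite sqr_ge0.
  rewrite dotE => h.
  rewrite -subr_ge0 -(@pmulr_rge0 _ (2 * enorm x * enorm y)).
    by apply: le_trans h _; rewrite le_eqVlt; apply/orP; left; apply/eqP; ring.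
  by rewrite !mulr_gt0.
rewrite -(@ler_pXn2r _ 2)// ?nnegrE ?addr_ge0 ?enorm_ge0// enorm_sqr.
have -> : \sum_i (x + y) 0 i ^+ 2 = \sum_i (1 * x 0 i + 1 * y 0 i) ^+ 2.
  by apply: eq_bigr => i _; rewrite mxE !mul1r.
by rewrite dotE; nra.
Qed.

Lemma translateK x : cancel (translate x) (translate (- x)).
Proof. by move=> y; rewrite /translate opprK subrK. Qed.

Lemma translateNK x : cancel (translate (- x)) (translate x).
Proof. by move=> y; rewrite /translate opprK addrK. Qed.

Lemma translate_inj x : injective (translate x).
Proof. exact: can_inj (translateK x). Qed.

Lemma image_translateK x A : translate (- x) @` (translate x @` A) = A.
Proof.
rewrite image_comp; apply/seteqP; split => [_ [y Ay <-]|y Ay] /=.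
  by rewrite translateK.
by exists y => //=; rewrite translateK.
Qed.

Lemma image_translateNK x A : translate x @` (translate (- x) @` A) = A.
Proof. by have := image_translateK (- x) A; rewrite opprK. Qed.

Lemma image_translateP x A y : (translate x @` A) y <-> A (y + x).
Proof.
split=> [[z Az <-]|Ayx]; first by rewrite /translate subrK.
by exists (y + x) => //; rewrite /translate addrK.
Qed.

Lemma cvg_addr x y : (fun z => z + x) @ y --> y + x.
Proof.
apply: (@cvgD _ _ _ (nbhs y) _ id (cst x)); [exact: cvg_id|exact: cvg_cst].
Qed.

Lemma is_delone_translate x r R L : is_delone r R L -> is_delone r R (translate x @` L).
Proof.
move=> [rR infL isoL unifL denseL]; split => //.
- move=> fin; apply: infL; rewrite -(image_translateK x L).
  exact: finite_image.
- move=> _ [y Ly <-].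
  have [_ [V nV VL]] := isoL _ Ly.
  split; first by apply: mem_set; exists y.
  exists (translate (- x) @^-1` V).
    have yE : translate x y + x = y by rewrite /translate subrK.
    have nV' : nbhs (translate x y + x) V by rewrite yE.
    rewrite (_ : _ @^-1` V = (fun z => z + x) @^-1` V); last first.
      by apply/seteqP; split => z; rewrite /= /translate opprK.
    exact: cvg_addr nV'.
  apply/seteqP; split => [z [/= Vz /image_translateP Lz]|_ ->] /=.
    have : (V `&` L) (z + x) by split => //; rewrite /translate opprK in Vz.
    by rewrite VL => /= <-; rewrite /translate addrK.
  have : (V `&` L) y by rewrite VL.
  by move=> [Vy _]; split; [rewrite translateK|exists y].
- move=> c _ _ [[y Ly <-] yc] [[z Lz <-] zc]; congr (translate x _).
  apply: (unifL (c + x)); split => //.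
    by move: yc; rewrite /eball/= /translate addrAC opprD addrA.
  by move: zc; rewrite /eball/= /translate addrAC opprD addrA.
- move=> c; have [y [Ly yc]] := denseL (c + x).
  exists (translate x y); split; first by exists y.
  by move: yc; rewrite /eball/= /translate addrAC opprD addrA.
Qed.

Lemma is_delone_limit_translate x r R L :
  is_delone_limit r R L -> is_delone_limit r R (translate x @` L).
Proof. by move=> [rR LD]; split => // r' /LD /is_delone_translate. Qed.

Lemma hausdorffC A B : hausdorff A B = hausdorff B A.
Proof.
have supE (C D : set 'rV[K]_d.+1) :
    [set ereal_inf [set (enorm (a - b))%:E | b in D] | a in C] =
    [set ereal_inf [set (enorm (b - a))%:E | b in D] | a in C].
  apply: eq_imagel => a _; congr ereal_inf.
  by apply: eq_imagel => b _; rewrite enormB.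
by rewrite /hausdorff maxC (supE A B) (supE B A).
Qed.

Lemma hausdorff_lt_ex A B (e : K) : (hausdorff A B < e%:E)%E ->
  forall a, A a -> exists2 b, B b & enorm (a - b) < e.
Proof.
rewrite /hausdorff gt_max => /andP[+ _] a Aa => h.
have : (ereal_inf [set (enorm (a - b))%:E | b in B] < e%:E)%E.
  by apply: le_lt_trans h; apply: ereal_sup_ubound; exists a.
by move=> /ereal_inf_lt[_ [b Bb <-]]; rewrite lte_fin; exists b.
Qed.

Lemma hausdorff_le A B (e : K) :
  (forall a, A a -> exists2 b, B b & enorm (a - b) <= e) ->
  (forall b, B b -> exists2 a, A a & enorm (b - a) <= e) ->
  (hausdorff A B <= e%:E)%E.
Proof.
move=> hA hB; rewrite /hausdorff ge_max; apply/andP; split.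
  apply: ge_ereal_sup => _ [a Aa <-]; have [b Bb ab] := hA _ Aa.
  apply: ge_ereal_inf; exists (enorm (a - b))%:E; first by exists b.
  by rewrite lee_fin.
apply: ge_ereal_sup => _ [b Bb <-]; have [a Aa ab] := hB _ Bb.
apply: ge_ereal_inf; exists (enorm (a - b))%:E; first by exists a.
by rewrite lee_fin enormB.
Qed.

Lemma trunc_translate_approx A B x rho y : 4 * (enorm x + 1) < rho ->
  (forall a, trunc A rho a -> exists2 b, trunc B rho b & enorm (a - b) < rho^-1) ->
  trunc (translate x @` A) (rho / 4) y ->
  exists2 z, trunc (translate x @` B) (rho / 4) z & enorm (y - z) <= 2 * rho^-1.
Proof.
move=> xrho AB; have x0 := enorm_ge0 x.
have rho4 : 4 < rho by lra.
have rho0 : 0 < rho by lra.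
have rhoV : 0 < rho^-1 < 1.
  by rewrite invr_gt0 rho0 invf_lt1//; lra.
have trivial_case : trunc (translate x @` B) (rho / 4) y ->
    exists2 z, trunc (translate x @` B) (rho / 4) z & enorm (y - z) <= 2 * rho^-1.
  move=> By; exists y => //; rewrite subrr (_ : enorm 0 = 0); first by lra.
  by rewrite -(scale0r (0 : 'rV[K]_d.+1)) enormZ normr0 mul0r.
case=> [[/image_translateP Ay]|ys]; last by apply: trivial_case; right.
rewrite /eball/= subr0 => yrho.
have yx : enorm (y + x) <= rho / 4 + enorm x.
  by apply: le_trans (enormD _ _) _; rewrite lerD2r.
have [|b] := AB (y + x).
  by left; split => //; rewrite /eball/= subr0; lra.
move=> + yb; case=> [[Bb _]|]; last first.
  rewrite /esphere/= subr0 => bs.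
  have := enormD (b - (y + x)) (y + x); rewrite subrK bs enormB; lra.
have ybx : y - (b - x) = y + x - b by rewrite opprB addrA.
have [bl|bg] := leP (enorm (b - x)) (rho / 4).
  exists (b - x); last by rewrite ybx; lra.
  left; split; first by apply/image_translateP; rewrite subrK.
  by rewrite /eball/= subr0.
pose w := b - x; have w0 : 0 < enorm w by rewrite /w; lra.
pose t := rho / 4 / enorm w.
have t01 : 0 < t <= 1 by rewrite /t divr_gt0 ?ler_pdivrMr//= ?mul1r; rewrite /w; lra.
have tw : t * enorm w = rho / 4 by rewrite /t divfK// gt_eqF.
have t0 : 0 < t by lra.
exists (t *: w).
  by right; rewrite /esphere/= subr0 enormZ gtr0_norm.
have -> : y - t *: w = (y - w) + (1 - t) *: w.
  by rewrite scalerBl scale1r addrA subrK.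
apply: le_trans (enormD _ _) _; rewrite enormZ ger0_norm; last by lra.
have := enormD (w - y) y; rewrite subrK enormB /w ybx => wle.
by rewrite mulrBl mul1r tw /w; lra.
Qed.

Lemma hull_translate x L0 L : hull L0 L -> hull L0 (translate x @` L).
Proof.
move=> [cL hL]; split.
  have -> : translate x @` L = (fun y => y + x) @^-1` L.
    by apply/seteqP; split => y /image_translateP.
  by apply: closed_comp => // y _; exact: cvg_addr.
move=> e e0; have x0 := enorm_ge0 x.
pose M := 4 * (enorm x + 1) + 4 * e^-1.
have eV : 0 < e^-1 by rewrite invr_gt0.
have M0 : 0 < (1 + M)^-1 by rewrite invr_gt0 /M; lra.
have [a /ereal_inf_lt[_ [rho [rho0 hrho] <-]]] := hL _ M0.
rewrite lte_fin ltf_pV2 ?posrE; [move=> Mrho|by lra|by rewrite /M; lra].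
have xrho : 4 * (enorm x + 1) < rho by move: Mrho; rewrite /M; lra.
exists (a + x).
have -> : translate (a + x) @` L0 = translate x @` (translate a @` L0).
  by rewrite image_comp; apply: eq_imagel => y _; rewrite /= /translate opprD addrA.
apply: (@le_lt_trans _ _ ((1 + rho / 4)^-1)%:E); last first.
  rewrite lte_fin -[ltRHS]invrK ltf_pV2 ?posrE//; last by lra.
  by move: Mrho; rewrite /M; lra.
apply: ereal_inf_lbound; exists (rho / 4) => //; split; first by lra.
apply: (@le_lt_trans _ _ (2 * rho^-1)%:E); last first.
  have rV : 0 < rho^-1 by rewrite invr_gt0.
  by rewrite lte_fin invfM invrK; lra.
apply: hausdorff_le => y; apply: trunc_translate_approx => //.
  exact: hausdorff_lt_ex.
by apply: hausdorff_lt_ex; rewrite hausdorffC.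
Qed.

End euclidean_facts.

(* A Delone set with [N = n.+1 >= 1] marked points, whose labels [1 .. N] are
   represented by ['I_n.+1]; in particular the label [1] is [ord0]. *)
Record marked_delone (K : realType) (d n : nat) (r R : K) := MarkedDelone {
  lat : set 'rV[K]_d.+1;
  pts : set 'rV[K]_d.+1;
  lab : 'I_n.+1 -> 'rV[K]_d.+1;
  lat_delone : is_delone_limit r R lat;
  pts_lat : pts `<=` lat;
  card_pts : (pts #= [set: 'I_n.+1])%card;
  lab_bij : set_bij [set: 'I_n.+1] pts lab }.

Section marked_delone.
Context {K : realType} {d n : nat} {r R : K}.
Local Notation T := (@marked_delone K d n r R).
Implicit Types (xi zeta : T) (x : 'rV[K]_d.+1) (e M : K).

HB.instance Definition _ := gen_eqMixin T.
HB.instance Definition _ := gen_choiceMixin T.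

Lemma marked_delone_eq xi zeta :
  lat xi = lat zeta -> pts xi = pts zeta -> lab xi = lab zeta -> xi = zeta.
Proof.
case: xi => L V c ? ? ? ?; case: zeta => L' V' c' ? ? ? ? /= LL VV cc.
by subst L' V' c'; congr MarkedDelone; exact: Prop_irrelevance.
Qed.

(* For [e < r / 2] there is at most one such [g] on [pts xi], since distinct
   points of a lattice are at distance at least [2 * r]. *)
Definition basic_nbhs xi e M : set T :=
  [set xi' | [/\ (hausdorff (trunc (lat xi) M) (trunc (lat xi') M) < e%:E)%E,
     (hausdorff (pts xi) (pts xi') < e%:E)%E &
     exists g : 'rV[K]_d.+1 -> 'rV[K]_d.+1,
       [/\ set_bij (pts xi) (pts xi') g,
           forall v, pts xi v -> enorm (g v - v) < e &
           lab xi' = g \o lab xi]]].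

(* The truncated Hausdorff distances are nondecreasing in [M], so that "for all
   large [M]" can equivalently be read as "for some [M > 0]". *)
Definition marked_open (U : set T) :=
  forall xi, U xi -> exists2 e, 0 < e < r / 2 &
    \forall M \near +oo, basic_nbhs xi e M `<=` U.

Lemma basic_nbhs_le xi e e' M :
  e <= e' -> basic_nbhs xi e M `<=` basic_nbhs xi e' M.
Proof.
move=> ee' xi' [lt1 lt2 [g [gbij gv lg]]]; split.
- by apply: lt_le_trans lt1 _; rewrite lee_fin.
- by apply: lt_le_trans lt2 _; rewrite lee_fin.
- by exists g; split => // v /gv /lt_le_trans; apply.
Qed.

Lemma marked_openT : marked_open setT.
Proof.
move=> xi _; have [/andP[r0 _] _] := lat_delone xi.
by exists (r / 4); [lra|near=> M].
Unshelve. all: by end_near. Qed.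

Lemma marked_openI : setI_closed marked_open.
Proof.
move=> U V oU oV xi [/oU[e he nU] /oV[e' he' nV]].
exists (Num.min e e'); first by rewrite lt_min gt_min; lra.
near=> M => xi' Bxi'; split.
  apply: (near nU M _) => //; apply: basic_nbhs_le Bxi'.
  by rewrite ge_min lexx.
apply: (near nV M _) => //; apply: basic_nbhs_le Bxi'.
by rewrite ge_min lexx orbT.
Unshelve. all: by end_near. Qed.

Lemma marked_open_bigU (I : Type) (f : I -> set T) :
  (forall i, marked_open (f i)) -> marked_open (\bigcup_i f i).
Proof.
move=> of_ xi [i _ /of_[e he nf]]; exists e => //.
by apply: filterS nf => M sub xi' /sub; exists i.
Qed.

HB.instance Definition _ :=
  isOpenTopological.Build T marked_openT marked_openI marked_open_bigU.

Lemma card_pts_translate x xi : (translate x @` pts xi #= [set: 'I_n.+1])%card.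
Proof.
apply: card_eq_trans (card_pts xi); apply: inj_card_eq => a b _ _.
exact: translate_inj.
Qed.

Lemma lab_bij_translate x xi :
  set_bij [set: 'I_n.+1] (translate x @` pts xi) (translate x \o lab xi).
Proof.
have [lab_fun lab_inj lab_surj] := lab_bij xi; split.
- by move=> i _; exists (lab xi i) => //; exact: lab_fun.
- by move=> i j iT jT /= /translate_inj; exact: lab_inj.
- by move=> _ [y /lab_surj[i iT <-] <-]; exists i.
Qed.

Definition mshift x xi : T :=
  MarkedDelone (is_delone_limit_translate x (lat_delone xi))
    (image_subset (translate x) (@pts_lat _ _ _ _ _ xi))
    (card_pts_translate x xi) (lab_bij_translate x xi).

Definition mshift2 x (p : T * T) : T * T := (mshift x p.1, mshift x p.2).

Lemma mshiftK x : cancel (mshift x) (mshift (- x)).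
Proof.
move=> xi; apply: marked_delone_eq; rewrite /= ?image_translateK//.
by apply/funext => i; exact: translateK.
Qed.

Lemma mshiftNK x : cancel (mshift (- x)) (mshift x).
Proof. by have := @mshiftK (- x); rewrite opprK. Qed.

End marked_delone.

Record groupoid_ops (G : Type) := GroupoidOps {
  composable : G -> G -> Prop;
  gmul : forall g h, composable g h -> G;
  ginv : G -> G;
  grange : G -> G;
  gsource : G -> G }.
Arguments gmul {G} _ {g h}.

Record is_groupoid (G : Type) (S : groupoid_ops G) : Prop := IsGroupoid {
  composableE : forall g h, composable S g h <-> gsource S g = grange S h;
  grangeE : forall g, exists c : composable S g (ginv S g),
    grange S g = gmul S c;
  gsourceE : forall g, exists c : composable S (ginv S g) g,
    gsource S g = gmul S c;
  ginvK : involutive (ginv S);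
  gmulA : forall g h k (gh : composable S g h) (hk : composable S h k),
    exists (gh_k : composable S (gmul S gh) k)
           (g_hk : composable S g (gmul S hk)), gmul S gh_k = gmul S g_hk;
  gmulKl : forall g h (gh : composable S g h),
    exists c : composable S (ginv S g) (gmul S gh), gmul S c = h;
  gmulKr : forall g h (gh : composable S g h),
    exists c : composable S (gmul S gh) (ginv S h), gmul S c = g }.

Definition composable_pairs (G : Type) (S : groupoid_ops G) : set (G * G) :=
  [set p | composable S p.1 p.2].

Definition gmul_pair (G : Type) (S : groupoid_ops G)
  (p : composable_pairs S) : G := gmul S (set_valP p).

Record is_topological_groupoid (G : topologicalType) (S : groupoid_ops G) :
    Prop := IsTopologicalGroupoid {
  tg_groupoid : is_groupoid S;
  tg_locally_compact : locally_compact [set: G];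
  tg_hausdorff : hausdorff_space G;
  tg_ginv : continuous (ginv S);
  tg_gsource : continuous (gsource S);
  tg_grange : continuous (grange S);
  tg_gmul : continuous (@gmul_pair G S) }.

Definition unit_space (G : Type) (S : groupoid_ops G) : set G :=
  range (grange S).

Definition range_to_units (G : Type) (S : groupoid_ops G) (g : G) :
    unit_space S :=
  SigSub (mem_set (imageT (grange S) g)).

Definition local_homeomorphism (X Y : topologicalType) (f : X -> Y) :=
  forall x, exists U : set X, [/\ open U, U x, open (f @` U),
    {within U, continuous f} &
    exists2 g : Y -> X,
      {in U, cancel f g} & {within f @` U, continuous g}].

Definition is_etale_groupoid (G : topologicalType) (S : groupoid_ops G) :=
  [/\ is_topological_groupoid S,
      local_homeomorphism (@range_to_units G S) &
      set_surj [set: G] [set: unit_space S] (@range_to_units G S)].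

Section marked_groupoid.
Context {K : realType} {d : nat} (n : nat) (r R : K) (L0 : set 'rV[K]_d.+1).
Local Notation T := (@marked_delone K d n r R).

Definition marked_pairs : set (T * T) := [set p | lat p.1 = lat p.2].

Definition marked_arrows : set (T * T) :=
  [set p | [/\ marked_pairs p, hull L0 (lat p.1) & lab p.1 ord0 = 0]].

Definition marked_units : set T :=
  [set xi | hull L0 (lat xi) /\ lab xi ord0 = 0].

Local Notation G := (set_type marked_arrows).
Implicit Types g h : G.

Definition base g : 'rV[K]_d.+1 := lab (\val g).2 ord0.

Lemma mrange_subproof g : marked_arrows ((\val g).1, (\val g).1).
Proof. by have [] := set_valP g. Qed.

Definition mrange g : G := SigSub (mem_set (mrange_subproof g)).

Lemma msource_subproof g :
  marked_arrows (mshift2 (base g) ((\val g).2, (\val g).2)).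
Proof.
have [gE hg _] := set_valP g; split => //=.
  by apply: hull_translate; rewrite -gE.
by rewrite /base /translate subrr.
Qed.

Definition msource g : G := SigSub (mem_set (msource_subproof g)).

Lemma minv_subproof g :
  marked_arrows (mshift2 (base g) ((\val g).2, (\val g).1)).
Proof.
have [gE hg _] := set_valP g; split.
- by rewrite /marked_pairs/= gE.
- by rewrite /=; apply: hull_translate; rewrite -gE.
- by rewrite /= /base /translate subrr.
Qed.

Definition minv g : G := SigSub (mem_set (minv_subproof g)).

Definition mcomposable g h := (\val h).1 = mshift (base g) (\val g).2.

Lemma mmul_subproof g h : mcomposable g h ->
  marked_arrows ((\val g).1, mshift (- base g) (\val h).2).
Proof.
have [gE hg g0] := set_valP g; have [hE _ _] := set_valP h.
move=> gh; split => //; rewrite /marked_pairs/= -hE.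
have := congr1 (@lat _ _ _ _ _) gh; rewrite /= => ->.
by rewrite image_translateK.
Qed.

(* For [g = (xi, zeta)] and [h] the translate of [(zeta, zeta')] by [base g],
   the second component below is [zeta']. *)
Definition mmul g h (gh : mcomposable g h) : G :=
  SigSub (mem_set (mmul_subproof gh)).

Definition marked_groupoid : groupoid_ops G :=
  GroupoidOps mmul minv mrange msource.

Lemma diag_subproof (xi : marked_units) : marked_arrows (\val xi, \val xi).
Proof. by have [] := set_valP xi. Qed.

Definition diag (xi : marked_units) : G := SigSub (mem_set (diag_subproof xi)).

Lemma undiag_subproof g : marked_units (\val g).1.
Proof. by have [] := set_valP g. Qed.

(* The unit space of the groupoid of marked pairs is homeomorphic to
   [marked_units], the pair [(xi, xi)] corresponding to [xi]. *)
Lemma unit_space_marked_subproof (xi : marked_units) :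
  unit_space marked_groupoid (diag xi).
Proof. by exists (diag xi) => //; exact: val_inj. Qed.

Definition unit_of_marked (xi : marked_units) : unit_space marked_groupoid :=
  SigSub (mem_set (unit_space_marked_subproof xi)).

Definition marked_of_unit (u : unit_space marked_groupoid) : marked_units :=
  SigSub (mem_set (undiag_subproof (\val u))).

Lemma unit_of_markedK : cancel unit_of_marked marked_of_unit.
Proof. by move=> xi; exact: val_inj. Qed.

Lemma marked_of_unitK : cancel marked_of_unit unit_of_marked.
Proof.
move=> u; have [g _ gu] := set_valP u; do 2 apply: val_inj.
have /= -> : \val u = mrange g by rewrite -[LHS]gu.
by [].
Qed.

Lemma continuous_set_val (X : topologicalType) (A : set X) :
  continuous (fun a : A => \val a).
Proof. exact: initial_continuous. Qed.

Lemma continuous_unit_of_marked : continuous unit_of_marked.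
Proof.
apply: (@continuous_comp_initial _ _ _ (fun u : unit_space _ => \val u)).
apply: (@continuous_comp_initial _ _ _ (fun g : G => \val g)) => xi.
apply: (@cvg_pair _ _ _ (nbhs xi) (nbhs (\val xi)) (nbhs (\val xi)) _ _ _
  (fun x => \val x) (fun x => \val x)); exact: continuous_set_val.
Qed.

Lemma continuous_marked_of_unit : continuous marked_of_unit.
Proof.
apply: (@continuous_comp_initial _ _ _ (fun x : marked_units => \val x)) => u.
apply: (@continuous_comp _ _ _ (fun v : unit_space marked_groupoid =>
  \val (\val v)) fst); last exact: cvg_fst.
apply: (@continuous_comp _ _ _ (fun v : unit_space marked_groupoid => \val v)
  (fun g : G => \val g)); exact: continuous_set_val.
Qed.

End marked_groupoid.

(* Main.v *)
Require Import Defs.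
From mathcomp Require Import all_boot all_order all_algebra.
From mathcomp Require Import lra.
From mathcomp Require Import all_classical all_reals all_analysis.
Set Implicit Arguments.
Unset Strict Implicit.
Unset Printing Implicit Defensive.
Import Order.TTheory GRing.Theory Num.Theory.
Import numFieldNormedType.Exports.
Local Open Scope classical_set_scope.
Local Open Scope ring_scope.

(** Locally, a marked Delone set is a lattice with finitely many labelled points
    that move with it, and everything follows from two facts about lattices.

    They are uniformly separated: two points at distance less than [2 * r]
    coincide ([delone_limit_separated]). So when a lattice is slightly perturbed,
    each marked point has exactly one nearby candidate to follow
    ([near_marked_follow]). In an arrow [(xi, zeta)] the lattice of [zeta] is that
    of [xi], and hence an arrow near [(xi, zeta)] is determined by its first
    component, which can be any unit near [xi]: the range map is locally injective
    ([range_to_units_locally_injective]) and open ([range_to_units_open]), thus a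
    local homeomorphism. Separation also makes the topology Hausdorff
    ([marked_hausdorff]).

    They form a compact space: along an ultrafilter, a family of lattices
    converges to the set of the limits of its points, which is separated and
    relatively dense again and stays in the hull ([limit_lattice_delone],
    [hull_limit_lattice]); the convergence is uniform on balls because these are
    compact ([limit_lattice_covers], [covers_limit_lattice]). A set of arrows
    whose labels are bounded is therefore compact ([compact_bounded_arrows]), and
    each arrow has such a neighborhood.

    The inversion, the source and the composition are built from projections,
    from labels and from translations [(x, xi) |-> mshift x xi]; hence they are
    continuous because translation is, jointly in both arguments
    ([continuous_mshift]). The axioms of groupoids are identities between
    translations.

    Neighborhoods in the space of marked Delone sets are described by [covers]
    and [near_marked] instead of Hausdorff distances between truncated sets
    ([nbhs_markedP]): the single parameter [e] stands for the tolerance [e] on the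
    ball of radius [e^-1]. *)

(** * The Euclidean norm *)

Section euclidean_norm.
Context {K : realType} {d : nat}.
Implicit Types (x y z c : 'rV[K]_d.+1) (e M : K).

Lemma enorm0 : enorm (0 : 'rV[K]_d.+1) = 0.
Proof. by rewrite -(scale0r (0 : 'rV[K]_d.+1)) enormZ normr0 mul0r. Qed.

Lemma enorm_triangle y x z : enorm (x - z) <= enorm (x - y) + enorm (y - z).
Proof. by have := enormD (x - y) (y - z); rewrite addrA subrK. Qed.

Lemma enorm_leB x y : enorm x <= enorm y + enorm (x - y).
Proof. by have := enormD y (x - y); rewrite addrC subrK. Qed.

Lemma enorm_eq x y : (forall e, 0 < e -> enorm (x - y) < e) -> x = y.
Proof.
move=> xy; apply/eqP; rewrite -subr_eq0; apply/eqP/enorm_eq0/eqP.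
rewrite eq_le enorm_ge0 andbT; apply/ler_addgt0Pr => e /xy /ltW.
by rewrite add0r.
Qed.

Lemma enorm_delta : enorm (delta_mx 0 0 : 'rV[K]_d.+1) = 1.
Proof.
rewrite /enorm (bigD1 0)//= big1 ?addr0 => [|i /negPf i0]; last first.
  by rewrite mxE eqxx i0 expr0n.
by rewrite mxE !eqxx expr1n sqrtr1.
Qed.

Lemma norm_coord_le_enorm x i : `|x 0 i| <= enorm x.
Proof.
rewrite -sqrtr_sqr ler_sqrt; last by apply: sumr_ge0 => j _; rewrite sqr_ge0.
by rewrite (bigD1 i)//= lerDl; apply: sumr_ge0 => j _; rewrite sqr_ge0.
Qed.

Lemma norm_le_enorm x : `|x| <= enorm x.
Proof.
rewrite [leLHS]/Num.norm /= mx_normrE; apply: bigmax_le => [|[i j] _] /=.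
  exact: enorm_ge0.
by rewrite [i]ord1 norm_coord_le_enorm.
Qed.

Lemma enorm_le_norm x : enorm x <= d.+1%:R * `|x|.
Proof.
have coord i : `|x 0 i| <= `|x|.
  by rewrite [leRHS]/Num.norm /= mx_normrE; exact: (le_bigmax _ _ (0, i)).
rewrite -[leRHS]ger0_norm ?mulr_ge0// -sqrtr_sqr ler_sqrt ?sqr_ge0//.
apply: (@le_trans _ _ (\sum_(i < d.+1) `|x| ^+ 2)).
  by apply: ler_sum => i _; rewrite -real_normK ?num_real// lerXn2r ?nnegrE.
rewrite sumr_const card_ord -[leLHS]mulr_natl exprMn.
by apply: ler_wpM2r; [exact: sqr_ge0|rewrite ler_eXnr// ler1n].
Qed.

(** The topology of row vectors comes from the sup norm, to which the Euclidean
    norm is equivalent. *)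
Lemma nbhs_enormP x (A : set 'rV[K]_d.+1) :
  nbhs x A <-> exists2 e, 0 < e & forall y, enorm (y - x) < e -> A y.
Proof.
rewrite nbhs_ballP; split=> -[e /= e0 eA].
  exists e => // y yx; apply: eA; rewrite mx_norm_ball /ball_/=.
  by apply: le_lt_trans yx; rewrite enormB norm_le_enorm.
exists (e / d.+1%:R) => /=; first by rewrite divr_gt0.
move=> y; rewrite mx_norm_ball /ball_/= ltr_pdivlMr// => yx; apply: eA.
by apply: le_lt_trans yx; rewrite enormB mulrC enorm_le_norm.
Qed.

Lemma enorm_near x e : 0 < e -> \forall y \near x, enorm (y - x) < e.
Proof. by move=> e0; apply/nbhs_enormP; exists e. Qed.

Lemma compact_norm_ball M : compact [set x : 'rV[K]_d.+1 | `|x| <= M].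
Proof.
apply: bounded_closed_compact.
  by exists M; split; [exact: num_real|move=> M' MM' x /= /le_trans; apply; exact: ltW].
have := @preimage_closed _ _ (fun x : 'rV[K]_d.+1 => `|x|) [set u | u <= M].
by apply => [x _|]; [exact: norm_continuous|exact: closed_le].
Qed.

(** Balls are relatively compact: finitely many of the neighborhoods on which
    [P] eventually holds already cover the ball of radius [M]. *)
Lemma near_bounded (I : Type) (F : set_system I) (P : I -> 'rV[K]_d.+1 -> Prop)
    M : Filter F ->
  (forall x, exists2 e, 0 < e &
    \forall i \near F, forall y, enorm (y - x) < e -> P i y) ->
  \forall i \near F, forall y, enorm y <= M -> P i y.
Proof.
move=> FF loc.
have /compact_near_coveringP/(_ _ F P FF) := @compact_norm_ball M.
move=> cov; apply: filterS (cov _) => [i sub y yM|x _].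
  by apply: sub => /=; apply: le_trans yM; exact: norm_le_enorm.
have [e e0 eP] := loc x.
exists ([set y | enorm (y - x) < e],
  [set i | forall y, enorm (y - x) < e -> P i y]) => /=.
  by split=> //; exact: enorm_near.
by move=> [y i] /= [yx iP]; exact: iP.
Qed.

(** If no point were a limit, then, [F] being an ultrafilter, each point would
    have a neighborhood that [u] eventually avoids, so that [u] would eventually
    avoid a whole ball that contains its values. *)
Lemma ultra_bounded_cvg (I : Type) (F : set_system I) (u : I -> 'rV[K]_d.+1) M :
  UltraFilter F -> (\forall i \near F, enorm (u i) <= M) ->
  exists x, forall e, 0 < e -> \forall i \near F, enorm (u i - x) < e.
Proof.
move=> FU uM; apply: contrapT => nx.
have FP : ProperFilter F by exact: ultra_proper.
have : \forall i \near F, forall y, enorm y <= M -> y <> u i.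
  apply: near_bounded => x.
  have /existsNP[e /not_implyP[e0 ne]] :
      ~ forall e, 0 < e -> \forall i \near F, enorm (u i - x) < e.
    by move=> h; apply: nx; exists x.
  exists e => //; have [//|] := in_ultra_setVsetC [set i | enorm (u i - x) < e] FU.
  by apply: filterS => i /= nux y yx yu; apply: nux; rewrite -yu.
by move=> /(filterI uM)/filter_ex[i [/= ui /(_ _ ui)]].
Qed.

End euclidean_norm.

(** * Approximation of closed sets and Delone sets *)

Section covers.
Context {K : realType} {d : nat}.
Implicit Types (x y a b : 'rV[K]_d.+1) (A B C L : set 'rV[K]_d.+1) (e M : K).

(** Symmetrized, this is the entourage of the topology of closed sets in which
    one number is both the tolerance and the inverse of the radius of
    observation. It refines and is refined by the Hausdorff distance between
    truncations, but, involving no sphere, it composes and translates well. *)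
Definition covers e A B :=
  forall a, A a -> enorm a <= e^-1 -> exists2 b, B b & enorm (a - b) < e.

Lemma covers_le e e' A B : 0 < e -> e <= e' -> covers e A B -> covers e' A B.
Proof.
move=> e0 ee' AB a Aa ae'; have [|b Bb ab] := AB a Aa.
  by apply: le_trans ae' _; rewrite lef_pV2// posrE//; exact: lt_le_trans ee'.
by exists b => //; exact: lt_le_trans ee'.
Qed.

(** The intermediate point may leave the ball of radius [(2 * e)^-1] by [e]; for
    [e <= 1 / 2] it is still in the ball of radius [e^-1]. *)
Lemma covers_trans B e A C :
  0 < e <= 1 / 2 -> covers e A B -> covers e B C -> covers (2 * e) A C.
Proof.
move=> /andP[e0 e1] AB BC a Aa; rewrite invfM => ae.
have eV : 1 <= e^-1 by rewrite invf_ge1//; lra.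
have [|b Bb ab] := AB a Aa; first by lra.
have [|c Cc bc] := BC b Bb.
  by have := enorm_leB b a; rewrite enormB; lra.
by exists c => //; have := enorm_triangle b a c; lra.
Qed.

Lemma covers_translate x y e A B : 0 < e -> e * enorm x <= 1 / 2 ->
  enorm (x - y) < e ->
  covers e A B -> covers (2 * e) (translate x @` A) (translate y @` B).
Proof.
move=> e0 ex xy AB _ [a Aa <-]; rewrite /translate invfM => axe.
have exV : enorm x <= 2^-1 * e^-1.
  by rewrite -ler_pdivrMr ?invr_gt0// invrK mulrC; lra.
have [|b Bb ab] := AB a Aa.
  by have := enorm_leB a (a - x); rewrite subKr; lra.
exists (b - y); first by exists b.
have -> : a - x - (b - y) = (a - b) - (x - y).
  by rewrite !opprB addrACA [in RHS]addrACA; congr (_ + _); rewrite addrC.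
by have := enormD (a - b) (- (x - y)); rewrite enormN; lra.
Qed.

(** A point of [A] in the ball of radius [M] can be close to points of [B]
    that lie outside of the ball only; it is then close to the sphere, which is
    why truncations contain it. *)
Lemma trunc_covers e A B M a : 0 < e -> 0 <= M <= e^-1 -> covers e A B ->
  trunc A M a -> exists2 b, trunc B M b & enorm (a - b) <= 2 * e.
Proof.
move=> e0 /andP[M0 Me] AB; case=> [[Aa]|aM]; last first.
  by exists a; [right|rewrite subrr enorm0; lra].
rewrite /eball/= subr0 => aM.
have [b Bb ab] := AB a Aa (le_trans aM Me).
have [bM|bM] := leP (enorm b) M.
  by exists b; [left; split => //; rewrite /eball/= subr0|lra].
pose t := M / enorm b; have b0 : 0 < enorm b by lra.
have tb : t * enorm b = M by rewrite /t divfK// gt_eqF.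
have t1 : 0 <= t <= 1 by rewrite /t divr_ge0 ?ler_pdivrMr//=; lra.
exists (t *: b); first by right; rewrite /esphere/= subr0 enormZ ger0_norm; lra.
have -> : a - t *: b = (a - b) + (1 - t) *: b.
  by rewrite scalerBl scale1r addrA subrK.
apply: le_trans (enormD _ _) _; rewrite enormZ ger0_norm; last by lra.
have := enorm_leB b a; rewrite enormB mulrBl mul1r tb; lra.
Qed.

Lemma covers_hausdorff e A B M : 0 < e -> 0 <= M <= e^-1 ->
  covers e A B -> covers e B A ->
  (hausdorff (trunc A M) (trunc B M) <= (2 * e)%:E)%E.
Proof. by move=> e0 Me AB BA; apply: hausdorff_le => a; exact: trunc_covers. Qed.

(** The margin [e] between [e^-1] and [M] excludes that the point of [trunc B M]
    close to a point of [A] be one that the sphere added. *)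
Lemma hausdorff_covers e A B M : 0 < e -> e^-1 + e <= M ->
  (hausdorff (trunc A M) (trunc B M) < e%:E)%E -> covers e A B.
Proof.
move=> e0 Me /hausdorff_lt_ex AB a Aa ae.
have [|b Bb ab] := AB a; first by left; split; rewrite // /eball/= subr0; lra.
exists b => //; case: Bb => [[]//|]; rewrite /esphere/= subr0 => bM.
by have := enorm_leB b a; rewrite enormB; lra.
Qed.

(** In [closed_dist] the radius [rho] must be large for the distance to be
    small, and the Hausdorff distance is then compared with [rho^-1]; with
    [rho] about [e^-1] this is the symmetrized [covers e]. *)
Lemma hull_covers (L0 L : set 'rV[K]_d.+1) : closed L ->
  hull L0 L <-> forall e, 0 < e -> exists a,
    covers e L (translate a @` L0) /\ covers e (translate a @` L0) L.
Proof.
move=> cL; split=> [[_ hL] e e0|hL].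
  have eV : 0 < e^-1 by rewrite invr_gt0.
  have eV0 : 0 < (1 + (e^-1 + e))^-1 by rewrite invr_gt0; lra.
  have [a /ereal_inf_lt[_ [rho [rho0 hrho] <-]]] := hL _ eV0.
  rewrite lte_fin ltf_pV2 ?posrE; [move=> erho|by lra|by lra].
  have rhoe : (rho^-1%:E <= e%:E :> \bar K)%E.
    by rewrite lee_fin -[leRHS]invrK lef_pV2 ?posrE//; lra.
  have erho' : e^-1 + e <= rho by lra.
  exists a; split; apply: (hausdorff_covers e0 erho').
    exact: lt_le_trans rhoe.
  by rewrite hausdorffC; exact: lt_le_trans rhoe.
split=> // e e0; have eV : 0 < e^-1 by rewrite invr_gt0.
have eV0 : 0 < e / 4 by lra.
have [a [ca ca']] := hL _ eV0.
exists a; apply: (@le_lt_trans _ _ ((1 + e^-1)^-1)%:E); last first.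
  by rewrite lte_fin -[ltRHS]invrK ltf_pV2 ?posrE//; lra.
apply: ereal_inf_lbound; exists e^-1 => //; split=> //.
apply: le_lt_trans (covers_hausdorff eV0 _ ca ca') _.
  by rewrite invfM invrK; lra.
by rewrite lte_fin invrK; lra.
Qed.

End covers.

Section delone.
Context {K : realType} {d : nat}.
Implicit Types (x y c : 'rV[K]_d.+1) (L : set 'rV[K]_d.+1) (r R e : K).

(** Two points at distance less than [2 * r] lie in the ball centered at their
    midpoint, of a radius [r'] that is still less than [r]. *)
Lemma delone_limit_separated r R L x y : is_delone_limit r R L ->
  L x -> L y -> enorm (x - y) < 2 * r -> x = y.
Proof.
move=> [rR del] Lx Ly xy; have xy0 := enorm_ge0 (x - y).
pose r' := (enorm (x - y) / 2 + r) / 2.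
have hr' : 0 < r' < r by rewrite /r'; lra.
have [_ _ _ unif _] := del _ hr'.
pose c := 2^-1 *: (x + y).
have half : `|2^-1 : K| * enorm (x - y) <= r'.
  by rewrite ger0_norm ?invr_ge0// /r'; lra.
apply: (unif c); split=> //; rewrite /eball/=.
  have -> : x - c = 2^-1 *: (x - y) by apply/rowP => i; rewrite !mxE; lra.
  by rewrite enormZ.
have -> : y - c = 2^-1 *: (y - x) by apply/rowP => i; rewrite !mxE; lra.
by rewrite enormZ enormB.
Qed.

Lemma delone_limit_dense r R L c : is_delone_limit r R L ->
  exists2 x, L x & enorm (x - c) <= R.
Proof.
move=> [rR del]; have hr' : 0 < r / 2 < r by lra.
by have [_ _ _ _ /(_ c)[x [Lx xc]]] := del _ hr'; exists x.
Qed.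

(** Separation and density are all that matters: a dense set is unbounded, hence
    infinite, and a separated set is discrete. *)
Lemma delone_limit_intro r R L : 0 < r < R ->
  (forall x y, L x -> L y -> enorm (x - y) < 2 * r -> x = y) ->
  (forall c, exists2 x, L x & enorm (x - c) <= R) ->
  is_delone_limit r R L.
Proof.
move=> rR sep dense; split=> // r' hr'; split.
- by lra.
- move=> /finite_seqP[s Ls].
  pose M := \sum_(x <- s) enorm x.
  have M0 : 0 <= M by apply: sumr_ge0 => x _; exact: enorm_ge0.
  have LM x : L x -> enorm x <= M.
    rewrite Ls /= => xs; rewrite /M (big_rem x)//= lerDl.
    by apply: sumr_ge0 => y _; exact: enorm_ge0.
  have [x /LM xM xc] := dense ((M + R + 1) *: delta_mx 0 0).
  have := enorm_leB ((M + R + 1) *: delta_mx 0 0) x.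
  by rewrite enormB enormZ enorm_delta ger0_norm; lra.
- move=> x Lx; split; first exact: mem_set.
  exists [set y | enorm (y - x) < 2 * r]; first by apply: enorm_near; lra.
  apply/seteqP; split=> [y [/= yx Ly]|_ ->] /=; first exact: sep.
  by split=> //; rewrite subrr enorm0; lra.
- move=> c x y [Lx xc] [Ly yc]; apply: sep => //.
  have := enorm_triangle c x y; rewrite (enormB c).
  by move: xc yc; rewrite /eball/=; lra.
- by move=> c; have [x Lx xc] := dense c; exists x.
Qed.

End delone.

(** * Limits of lattices along an ultrafilter *)

Section limit_lattice.
Context {K : realType} {d : nat} {I : Type} (F : set_system I).
Context {FU : UltraFilter F}.
Variable Lam : I -> set 'rV[K]_d.+1.
Implicit Types (x y p : 'rV[K]_d.+1) (r R e : K).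

Let FP : ProperFilter F. Proof. exact: ultra_proper. Qed.

(** Along an ultrafilter a family of subsets of space always converges; this is
    its limit, the set of the limits of its points. *)
Definition limit_lattice : set 'rV[K]_d.+1 := [set x | forall e, 0 < e ->
  \forall i \near F, exists2 p, Lam i p & enorm (p - x) < e].

Lemma closed_limit_lattice : closed limit_lattice.
Proof.
move=> x clx e e0; have e2 : 0 < e / 2 by lra.
have [y [Ly /= yx]] := clx _ (enorm_near x e2).
apply: filterS (Ly _ e2) => i [p Lp py]; exists p => //.
by have := enorm_triangle y p x; lra.
Qed.

Lemma mem_limit_lattice (u : I -> 'rV[K]_d.+1) x :
  (\forall i \near F, Lam i (u i)) ->
  (forall e, 0 < e -> \forall i \near F, enorm (u i - x) < e) ->
  limit_lattice x.
Proof.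
move=> uL ux e /ux; apply: filterS2 uL => i Lu ue.
by exists (u i).
Qed.

(** Points of [Lam i] that approximate [x] and [y] are eventually at distance
    less than [2 * r], hence equal. *)
Lemma limit_lattice_separated r R x y :
  (forall i, is_delone_limit r R (Lam i)) ->
  limit_lattice x -> limit_lattice y -> enorm (x - y) < 2 * r -> x = y.
Proof.
move=> del Lx Ly xy; apply: enorm_eq => e e0.
pose t := Num.min (e / 2) (r - enorm (x - y) / 2).
have t0 : 0 < t by rewrite lt_min; lra.
have [te tr] : t <= e / 2 /\ t <= r - enorm (x - y) / 2.
  by rewrite !ge_min !lexx orbT.
have [i [[p Lp px] [q Lq qy]]] := filter_ex (filterI (Lx _ t0) (Ly _ t0)).
have pq : p = q.
  apply: (delone_limit_separated (del i)) => //.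
  have := enorm_triangle x p q; have := enorm_triangle y x q.
  by rewrite (enormB y q); lra.
by have := enorm_triangle p x y; rewrite {2}pq (enormB x p); lra.
Qed.

(** The limit of a point chosen in the ball for each [i] is in the ball. *)
Lemma limit_lattice_dense r R c : (forall i, is_delone_limit r R (Lam i)) ->
  exists2 x, limit_lattice x & enorm (x - c) <= R.
Proof.
move=> del.
have /choice[u uP] : forall i, exists x, Lam i x /\ enorm (x - c) <= R.
  by move=> i; have [x] := delone_limit_dense c (del i); exists x.
have uM : \forall i \near F, enorm (u i) <= enorm c + R.
  near=> i; have [_ uc] := uP i; have := enorm_leB (u i) c; lra.
have [x ux] := ultra_bounded_cvg FU uM; exists x.
  by apply: mem_limit_lattice ux; near=> i; have [] := uP i.
apply/ler_addgt0Pr => e /ux /filter_ex[i]; rewrite enormB => uxe.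
by have [_ uc] := uP i; have := enorm_triangle (u i) x c; lra.
Unshelve. all: by end_near. Qed.

Lemma limit_lattice_delone r R : 0 < r < R ->
  (forall i, is_delone_limit r R (Lam i)) -> is_delone_limit r R limit_lattice.
Proof.
move=> rR del; apply: delone_limit_intro => // [x y|c].
  exact: (limit_lattice_separated del).
exact: (limit_lattice_dense c del).
Qed.

(** Each point of the limit is approximated by definition; that this is uniform
    on a ball is its compactness. *)
Lemma limit_lattice_covers e : 0 < e ->
  \forall i \near F, covers e limit_lattice (Lam i).
Proof.
move=> e0; have e4 : 0 < e / 4 by lra.
suff : \forall i \near F, forall x, enorm x <= e^-1 ->
    limit_lattice x -> exists2 p, Lam i p & enorm (x - p) < e.
  by apply: filterS => i h x Lx xe; exact: h.
apply: near_bounded => x; exists (e / 4) => //.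
have [[z [Lz zx]]|nz] :=
  pselect (exists z, limit_lattice z /\ enorm (z - x) < e / 4).
  apply: filterS (Lz _ e4) => i [p Lp pz] y yx _; exists p => //.
  have := enorm_triangle x y p; have := enorm_triangle z x p.
  by rewrite (enormB z p) (enormB x z); lra.
by near=> i => y yx Ly; exfalso; apply: nz; exists y.
Unshelve. all: by end_near. Qed.

(** A point outside of the limit has a neighborhood that does not eventually
    meet [Lam i], hence, [F] being an ultrafilter, that eventually does not meet
    [Lam i]; compactness makes this uniform on a ball. *)
Lemma covers_limit_lattice e : 0 < e ->
  \forall i \near F, covers e (Lam i) limit_lattice.
Proof.
move=> e0.
suff : \forall i \near F, forall p, enorm p <= e^-1 ->
    Lam i p -> exists2 x, limit_lattice x & enorm (p - x) < e.
  by apply: filterS => i h p Lp pe; exact: h.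
apply: near_bounded => x; have [Lx|] := pselect (limit_lattice x).
  by exists e => //; near=> i => p px _; exists x.
move=> /existsNP[t /not_implyP[t0 nt]]; exists t => //.
have [//|] := in_ultra_setVsetC [set i | exists2 p, Lam i p & enorm (p - x) < t] FU.
by apply: filterS => i /= np p px Lp; exfalso; apply: np; exists p.
Unshelve. all: by end_near. Qed.

Lemma hull_limit_lattice (L0 : set 'rV[K]_d.+1) :
  (forall i, hull L0 (Lam i)) -> hull L0 limit_lattice.
Proof.
move=> hL; apply/(hull_covers L0 closed_limit_lattice) => e e0.
pose t := Num.min (e / 2) (1 / 2).
have ht : 0 < t <= 1 / 2 by rewrite lt_min ge_min lexx orbT; lra.
have te : 2 * t <= e by rewrite mulrC -ler_pdivlMr// ge_min lexx.
have t0 : 0 < t by lra.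
have [i [/= LLi LiL]] :=
  filter_ex (filterI (limit_lattice_covers t0) (covers_limit_lattice t0)).
have [a [ca ca']] := (hull_covers L0 (hL i).1).1 (hL i) _ t0.
have t20 : 0 < 2 * t by lra.
exists a; split; apply: (covers_le t20 te).
  exact: (covers_trans ht LLi ca).
exact: (covers_trans ht ca' LiL).
Qed.

End limit_lattice.

(** * The topology of marked Delone sets *)

Section marked_topology.
Context {K : realType} {d n : nat} {r R : K}.
Local Notation T := (@marked_delone K d n r R).
Implicit Types (xi zeta : T) (x y : 'rV[K]_d.+1) (e M : K).

(** A simpler form of [basic_nbhs]: the marked points are the values of the
    labelling, so that comparing the labels bounds the distance between the sets
    of marked points and forces the bijection [g]. *)
Definition near_marked xi e : set T :=
  [set xi' | [/\ covers e (lat xi) (lat xi'), covers e (lat xi') (lat xi) &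
                 forall i, enorm (lab xi' i - lab xi i) < e]].

Lemma pts_range_lab xi : pts xi = range (lab xi).
Proof.
have [labf _ labs] := lab_bij xi; apply/seteqP; split=> [y /labs[i _ <-]|_ [i _ <-]].
  by exists i.
exact: labf.
Qed.

Lemma lab_inj xi : injective (lab xi).
Proof. by move=> i j; have [_ inj _] := lab_bij xi; apply: inj; exact: mem_set. Qed.

Lemma lab_lat xi i : lat xi (lab xi i).
Proof. by apply: pts_lat; rewrite pts_range_lab; exists i. Qed.

Lemma marked_delone_lab_eq xi zeta :
  lat xi = lat zeta -> lab xi = lab zeta -> xi = zeta.
Proof. by move=> latE labE; apply: marked_delone_eq; rewrite // !pts_range_lab labE. Qed.

Lemma near_marked_refl xi e : 0 < e -> near_marked xi e xi.
Proof.
move=> e0; split=> [a La _|a La _|i]; last by rewrite subrr enorm0.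
  by exists a; rewrite // subrr enorm0.
by exists a; rewrite // subrr enorm0.
Qed.

Lemma near_marked_le xi e e' : 0 < e -> e <= e' ->
  near_marked xi e `<=` near_marked xi e'.
Proof.
move=> e0 ee' zeta [c1 c2 labe].
by split; [exact: covers_le c1|exact: covers_le c2|move=> i; exact: lt_le_trans ee'].
Qed.

Lemma near_marked_trans xi zeta e : 0 < e <= 1 / 2 -> near_marked xi e zeta ->
  near_marked zeta e `<=` near_marked xi (2 * e).
Proof.
move=> he [c1 c2 labe] zeta' [c1' c2' labe']; split.
- exact: covers_trans c1 c1'.
- exact: covers_trans c2' c2.
- move=> i; have := enorm_triangle (lab zeta i) (lab zeta' i) (lab xi i).
  by move: (labe i) (labe' i); lra.
Qed.

Lemma basic_nbhs_near_marked xi e M : 0 < e -> e^-1 + e <= M ->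
  basic_nbhs xi e M `<=` near_marked xi e.
Proof.
move=> e0 eM zeta [hL _ [g [_ gv lg]]]; split.
- exact: hausdorff_covers hL.
- by apply: (hausdorff_covers e0 eM); rewrite hausdorffC.
- by move=> i; rewrite lg/=; apply: gv; rewrite pts_range_lab; exists i.
Qed.

Lemma near_marked_basic_nbhs xi e M : 0 < e -> 0 <= M <= e^-1 ->
  near_marked xi e `<=` basic_nbhs xi (3 * e) M.
Proof.
move=> e0 eM zeta [c1 c2 labe]; split.
- apply: le_lt_trans (covers_hausdorff e0 eM c1 c2) _.
  by rewrite lte_fin; lra.
- apply: (@le_lt_trans _ _ e%:E); last by rewrite lte_fin; lra.
  rewrite !pts_range_lab.
  apply: hausdorff_le => _ [i _ <-].
    by exists (lab zeta i); rewrite // enormB ltW.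
  by exists (lab xi i); rewrite // ltW.
(* the default value only matters outside of [pts xi] *)
pose g y := lab zeta (odflt ord0 [pick i | lab xi i == y]).
have gE i : g (lab xi i) = lab zeta i.
  rewrite /g; case: pickP => [j /eqP/lab_inj->//|/(_ i)].
  by rewrite eqxx.
exists g; split.
- rewrite !pts_range_lab; split.
  + by move=> _ [i _ <-]; rewrite gE; exists i.
  + move=> _ _ /set_mem[i _ <-] /set_mem[j _ <-].
    by rewrite !gE => /lab_inj ->.
  + by move=> _ [i _ <-]; exists (lab xi i); [exists i|exact: gE].
- rewrite pts_range_lab => _ [i _ <-]; rewrite gE.
  by apply: lt_trans (labe i) _; lra.
- by apply/funext => i; rewrite /= gE.
Qed.

(** The topology only declares open the sets that contain a basic neighborhood of
    each of their points. That basic neighborhoods are neighborhoods in this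
    sense follows from [near_marked_trans]: the points around which some
    [near_marked] set is contained in [U] form an open set. *)
Lemma nbhs_markedP xi (U : set T) :
  nbhs xi U <-> exists2 e, 0 < e & near_marked xi e `<=` U.
Proof.
split=> [[B [oB Bxi BU]]|[e e0 eU]].
  have [e he nearB] := oB _ Bxi.
  have [M [M0 MB]] : exists M, 0 < M /\ basic_nbhs xi e M `<=` B.
    apply: (@filter_ex _ +oo); apply: filterI nearB.
    exact: nbhs_pinfty_gt.
  have MV : 0 < M^-1 by rewrite invr_gt0.
  pose t := Num.min (e / 3) M^-1.
  have t0 : 0 < t by rewrite lt_min; lra.
  have tM : M <= t^-1 by rewrite -[M]invrK lef_pV2// ?posrE// ge_min lexx orbT.
  exists t => //; apply: subset_trans BU; apply: subset_trans MB.
  have hM : 0 <= M <= t^-1 by rewrite ltW.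
  apply: subset_trans (near_marked_basic_nbhs t0 hM) _; apply: basic_nbhs_le.
  by rewrite mulrC -ler_pdivlMr// ge_min lexx.
(* the interior of [U] *)
exists [set zeta | exists2 t, 0 < t & near_marked zeta t `<=` U]; split.
- move=> zeta [t t0 tU]; have [/andP[r0 _] _] := lat_delone zeta.
  pose s := Num.min (t / 2) (Num.min (1 / 2) (r / 4)).
  have s0 : 0 < s by rewrite !lt_min; lra.
  have [st [s1 sr]] : s <= t / 2 /\ s <= 1 / 2 /\ s <= r / 4.
    by rewrite !ge_min !lexx /= !orbT.
  exists s; first by lra.
  near=> M => zeta' /(basic_nbhs_near_marked s0) nz'; exists s => //.
  apply: subset_trans tU; have s20 : 0 < 2 * s by lra.
  have st' : 2 * s <= t by lra.
  apply: subset_trans (near_marked_le s20 st').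
  apply: near_marked_trans; first by lra.
  by apply: nz'; near: M; apply: nbhs_pinfty_ge; rewrite num_real.
- by exists e.
- by move=> zeta [t t0]; apply; exact: near_marked_refl.
Unshelve. all: by end_near. Qed.

Lemma near_markedW xi e : 0 < e -> nbhs xi (near_marked xi e).
Proof. by move=> e0; apply/nbhs_markedP; exists e. Qed.

Lemma continuous_lab i : continuous (fun xi => lab xi i).
Proof.
move=> xi A /nbhs_enormP[e e0 eA]; apply/nbhs_markedP; exists e => //.
by move=> zeta [_ _ labe]; apply: eA; exact: labe.
Qed.

Lemma continuous_mshift : continuous (fun p : 'rV[K]_d.+1 * T => mshift p.1 p.2).
Proof.
move=> [x xi] A /nbhs_markedP[e e0 eA].
(* [t * (enorm x + 1) <= 1 / 2], so that [covers_translate] applies to [x] and to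
   all [y] at distance at most [1] from [x] *)
have x0 := enorm_ge0 x; have r0 : 0 < (2 * enorm x + 2)^-1 by rewrite invr_gt0; lra.
pose t := Num.min (e / 2) (Num.min 1 (2 * enorm x + 2)^-1).
have t0 : 0 < t by rewrite !lt_min; lra.
have [te [t1 tx]] : t <= e / 2 /\ t <= 1 /\ t <= (2 * enorm x + 2)^-1.
  by rewrite !ge_min !lexx /= !orbT.
have txM : t * (2 * enorm x + 2) <= 1 by rewrite -ler_pdivlMr ?div1r//; lra.
have near_shift y : enorm y <= enorm x + 1 -> t * enorm y <= 1 / 2.
  by move=> yx; have := ler_wpM2l (ltW t0) yx; lra.
exists ([set y | enorm (y - x) < t], near_marked xi t) => /=.
  by split; [exact: enorm_near|exact: near_markedW].
move=> [y zeta] /= [yx [c1 c2 labt]]; apply: eA => /=.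
have t20 : 0 < 2 * t by lra.
have te' : 2 * t <= e by lra.
have yx1 : enorm y <= enorm x + 1 by have := enorm_leB y x; lra.
apply: near_marked_le te' _ _ => //; split => /=.
- by apply: covers_translate => //; [apply: near_shift; lra|rewrite enormB].
- by apply: covers_translate => //; apply: near_shift; lra.
- move=> i; rewrite /translate.
  have -> : lab zeta i - y - (lab xi i - x) = (lab zeta i - lab xi i) - (y - x).
    by rewrite !opprB addrACA [in RHS]addrACA; congr (_ + _); rewrite addrC.
  have := enormD (lab zeta i - lab xi i) (- (y - x)); rewrite enormN.
  by move: (labt i); lra.
Qed.

(** A point [x] of [lat xi] has points of [lat zeta] at arbitrarily small
    distance; as [lat zeta] is separated, those closer than [r] coincide, so
    that [x] is one of them. *)
Lemma marked_hausdorff : hausdorff_space T.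
Proof.
have sub xi zeta : cluster (nbhs xi) zeta -> lat xi `<=` lat zeta.
  move=> cl x Lx; have [/andP[r0 _] _] := lat_delone xi.
  have ex e : 0 < e -> exists2 y, lat zeta y & enorm (x - y) < e.
    move=> e0; have x0 := enorm_ge0 x.
    have xV : 0 < (2 * enorm x + 2)^-1 by rewrite invr_gt0; lra.
    pose t := Num.min (e / 2) (Num.min (1 / 2) (2 * enorm x + 2)^-1).
    have t0 : 0 < t by rewrite !lt_min; lra.
    have [te [t1 tx]] : t <= e / 2 /\ t <= 1 / 2 /\ t <= (2 * enorm x + 2)^-1.
      by rewrite !ge_min !lexx /= !orbT.
    have [w [[c1 _ _] [_ c2 _]]] :=
      cl _ _ (near_markedW xi t0) (near_markedW zeta t0).
    have ht : 0 < t <= 1 / 2 by lra.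
    have xt : enorm x <= (2 * t)^-1.
      have : 2 * enorm x + 2 <= t^-1.
        by rewrite -[leLHS]invrK lef_pV2 ?posrE//; lra.
      by rewrite invfM; lra.
    have [y Ly xy] := covers_trans ht c1 c2 Lx xt.
    by exists y => //; lra.
  have [y Ly xy] := ex r r0.
  suff -> : x = y by [].
  apply: enorm_eq => e e0.
  have m0 : 0 < Num.min e r by rewrite lt_min e0.
  have [z Lz xz] := ex _ m0; move: xz; rewrite lt_min => /andP[xze xzr].
  suff -> : y = z by [].
  apply: (delone_limit_separated (lat_delone zeta)) => //.
  by have := enorm_triangle x y z; rewrite (enormB y x); lra.
move=> xi zeta cl; apply: marked_delone_lab_eq.
  apply/seteqP; split; apply: sub => // A B nA nB.
  by rewrite setIC; exact: cl.
apply/funext => i; apply: enorm_eq => e e0; have e2 : 0 < e / 2 by lra.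
have [w [[_ _ /(_ i) l1] [_ _ /(_ i) l2]]] :=
  cl _ _ (near_markedW xi e2) (near_markedW zeta e2).
have := enorm_triangle (lab w i) (lab xi i) (lab zeta i).
by rewrite (enormB (lab xi i) (lab w i)); lra.
Qed.

End marked_topology.

(** * Limits and continuation of marked Delone sets *)

Section set_type_topology.
Context {X : topologicalType} {A : set X}.

Lemma nbhs_set_typeP (x : A) (U : set A) :
  nbhs x U <-> exists2 B, nbhs (\val x) B & forall y : A, B (\val y) -> U y.
Proof.
split=> [[_ [[B oB <-] /= Bx BU]]|[B nB BU]].
  by exists B; [exact: open_nbhs_nbhs|move=> y By; exact: BU].
apply: filterS (_ : nbhs x (\val @^-1` B)) => [y|]; first exact: BU.
exact: (@continuous_set_val _ A x B nB).
Qed.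

End set_type_topology.

Lemma continuous_pair (X Y Z : topologicalType) (f : X -> Y) (g : X -> Z) :
  continuous f -> continuous g -> continuous (fun x => (f x, g x)).
Proof.
move=> cf cg x.
apply: (@cvg_pair _ _ _ (nbhs x) (nbhs (f x)) (nbhs (g x)) _ _ _ f g).
  exact: cf.
exact: cg.
Qed.

(** The local inverse is continuous because [f] is open. *)
Lemma local_homeomorphism_intro (X Y : topologicalType) (f : X -> Y) :
  continuous f ->
  (forall x A, nbhs x A -> nbhs (f x) (f @` A)) ->
  (forall x, exists U, [/\ open U, U x &
    forall u v, U u -> U v -> f u = f v -> u = v]) ->
  local_homeomorphism f.
Proof.
move=> cf opf injf x; have [U [oU Ux injU]] := injf x.
have ofU : open (f @` U).
  rewrite openE => _ [u Uu <-]; apply: opf; exact: open_nbhs_nbhs.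
exists U; split => //; first exact: continuous_subspaceT.
pose g y := xget x [set u | U u /\ f u = y].
have gK u : U u -> g (f u) = u.
  move=> Uu; rewrite /g; case: xgetP => [v _ [Uv fvu]|/(_ u)[]//].
  exact: injU.
exists g; first by move=> u /set_mem; exact: gK.
rewrite continuous_open_subspace// => _ /set_mem[u Uu <-] A.
rewrite gK// => nA; have nAU : nbhs u (A `&` U).
  by apply: filterI => //; exact: open_nbhs_nbhs.
apply: filterS (opf _ _ nAU) => _ [v [Av Uv] <-] /=.
by rewrite gK.
Qed.

Section marked_delone_limits.
Context {K : realType} {d n : nat} {r R : K}.
Local Notation T := (@marked_delone K d n r R).
Implicit Types (xi zeta : T) (e : K).

Lemma marked_delone_ex (L : set 'rV[K]_d.+1) (l : 'I_n.+1 -> 'rV[K]_d.+1) :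
  is_delone_limit r R L -> injective l -> (forall i, L (l i)) ->
  exists2 zeta : T, lat zeta = L & lab zeta = l.
Proof.
move=> del linj lL.
have sub : range l `<=` L by move=> _ [i _ <-].
have card : (range l #= [set: 'I_n.+1])%card.
  by apply: inj_card_eq => i j _ _; exact: linj.
have bij : set_bij [set: 'I_n.+1] (range l) l.
  split=> [i _|i j _ _|_ [i _ <-]]; [by exists i|exact: linj|by exists i].
by exists (MarkedDelone del sub card bij).
Qed.

(** The lattices converge in any case, and the labels do because they are
    bounded. Distinct labels have distinct limits, being at distance at least
    [2 * r] from each other. *)
Lemma marked_ultra_cvg (I : Type) (F : set_system I) (xi : I -> T)
    (M : 'I_n.+1 -> K) : UltraFilter F -> 0 < r < R ->
  (forall j, \forall i \near F, enorm (lab (xi i) j) <= M j) ->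
  exists2 zeta, lat zeta = limit_lattice F (fun i => lat (xi i)) &
    xi @ F --> zeta.
Proof.
move=> FU rR bnd; have FP : ProperFilter F by exact: ultra_proper.
have /choice[l lP] j := ultra_bounded_cvg FU (bnd j).
have del i : is_delone_limit r R (lat (xi i)) := lat_delone (xi i).
have [||zeta latE labE] := marked_delone_ex (l := l) (limit_lattice_delone rR del).
- move=> j k jk; have r0 : 0 < r by lra.
  have [i [lj lk]] := filter_ex (filterI (lP j _ r0) (lP k _ r0)).
  apply: (@lab_inj _ _ _ _ _ (xi i)).
  apply: (delone_limit_separated (del i)); try exact: lab_lat.
  have := enorm_triangle (l j) (lab (xi i) j) (lab (xi i) k).
  by rewrite {2}jk (enormB (l k)); lra.
- move=> j; apply: (mem_limit_lattice (u := fun i => lab (xi i) j)) (lP j).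
  by apply: filterE => i; exact: lab_lat.
exists zeta => // A /nbhs_markedP[e e0 eA].
have labP : \forall i \near F, forall j, enorm (lab (xi i) j - l j) < e.
  by apply: filter_forall => j; exact: lP.
have cP := @limit_lattice_covers _ _ _ _ FU (fun i => lat (xi i)) _ e0.
have cP' := @covers_limit_lattice _ _ _ _ FU (fun i => lat (xi i)) _ e0.
apply: filterS3 labP cP cP' => i li ci ci'; apply: eA.
by split; rewrite ?latE// labE.
Qed.

(** Every point of [lat zeta] has a point nearby in every lattice close to
    [lat zeta], so that the marked points of [zeta] can be followed there. *)
Lemma near_marked_follow xi zeta e : 0 < e -> lat xi = lat zeta ->
  \forall xi' \near xi, exists2 zeta', lat zeta' = lat xi' &
    near_marked zeta e zeta'.
Proof.
move=> e0 latE; have [/andP[r0 _] _] := lat_delone zeta.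
have near_point j : \forall xi' \near xi, exists y, lat xi' y /\
    enorm (lab zeta j - y) < Num.min e r.
  have z0 := enorm_ge0 (lab zeta j).
  have zV : 0 < (enorm (lab zeta j) + 1)^-1 by rewrite invr_gt0; lra.
  pose t := Num.min (Num.min e r) (enorm (lab zeta j) + 1)^-1.
  have t0 : 0 < t by rewrite !lt_min e0 r0.
  have zt : enorm (lab zeta j) <= t^-1.
    apply: (@le_trans _ _ (enorm (lab zeta j) + 1)); first by lra.
    by rewrite -[leLHS]invrK lef_pV2 ?posrE// /t ge_min lexx orbT.
  apply: filterS (near_markedW xi t0) => xi' [+ _ _] => /(_ (lab zeta j)).
  rewrite latE => /(_ (lab_lat zeta j) zt)[y Ly zy]; exists y; split => //.
  by apply: lt_le_trans zy _; rewrite ge_min lexx.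
have near_points : \forall xi' \near xi, forall j, exists y, lat xi' y /\
    enorm (lab zeta j - y) < Num.min e r 
  by apply: (filter_forall (nbhs_filter xi)) => j; exact: near_point.
have nW : nbhs xi (near_marked xi e) by exact: near_markedW.
apply: filterS (filterI near_points nW) => xi'.
move=> [/choice[l lP] [c1 c2 _]].
have [||zeta' latE' labE'] := marked_delone_ex (l := l) (lat_delone xi').
- move=> i j ij; have [_ lei] := lP i; have [_ lej] := lP j.
  move: lei lej; rewrite !lt_min => /andP[_ ri] /andP[_ rj].
  apply: (@lab_inj _ _ _ _ _ zeta).
  apply: (delone_limit_separated (lat_delone zeta)); try exact: lab_lat.
  have := enorm_triangle (l i) (lab zeta i) (lab zeta j).
  by rewrite {2}ij (enormB (l j)); lra.
- by move=> i; have [] := lP i.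
exists zeta' => //; split; rewrite ?latE' -?latE// => i.
have [_] := lP i; rewrite lt_min => /andP[+ _].
by rewrite labE' enormB.
Qed.

End marked_delone_limits.

(** * The groupoid of marked pairs *)

Section marked_groupoid_theory.
Context {K : realType} {d n : nat} {r R : K} {L0 : set 'rV[K]_d.+1}.
Local Notation T := (@marked_delone K d n r R).
Local Notation G := (set_type (@marked_arrows K d n r R L0)).
Local Notation S := (@marked_groupoid K d n r R L0).
Implicit Types (xi zeta : T) (g h k : G).

Lemma mshiftD (x y : 'rV[K]_d.+1) xi : mshift x (mshift y xi) = mshift (y + x) xi.
Proof.
have trD z : translate x (translate y z) = translate (y + x) z.
  by rewrite /translate opprD addrA.
apply: marked_delone_lab_eq => /=; last by apply/funext => i; exact: trD.
by rewrite image_comp; apply: eq_imagel => z _; exact: trD.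
Qed.

Lemma mshift0 xi : mshift 0 xi = xi.
Proof.
have tr0 z : translate 0 z = z :> 'rV[K]_d.+1 by rewrite /translate subr0.
apply: marked_delone_lab_eq => /=; last by apply/funext => i; exact: tr0.
by rewrite -[RHS]image_id; apply: eq_imagel => z _; exact: tr0.
Qed.

Lemma arrow_eq g h : (\val g).1 = (\val h).1 -> (\val g).2 = (\val h).2 -> g = h.
Proof.
move=> e1 e2; apply: val_inj.
by rewrite [LHS]surjective_pairing e1 e2 -surjective_pairing.
Qed.

Lemma base_mmul g h (gh : mcomposable g h) : base (mmul gh) = base h + base g.
Proof. by rewrite /base /= /translate opprK. Qed.

Lemma base_minv g : base (minv g) = - base g.
Proof.
by have [_ _ g0] := set_valP g; rewrite {1}/base /= g0 /translate sub0r.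
Qed.

Lemma mcomposable_minvr g : mcomposable g (minv g).
Proof. by []. Qed.

Lemma mcomposable_minvl g : mcomposable (minv g) g.
Proof. by rewrite /mcomposable base_minv /= mshiftK. Qed.

Lemma marked_is_groupoid : is_groupoid S.
Proof.
have mulA_l g h k (gh : mcomposable g h) (hk : mcomposable h k) :
    mcomposable (mmul gh) k.
  by rewrite /mcomposable base_mmul /= hk mshiftD addrC addrK.
have mulA_r g h k (gh : mcomposable g h) (hk : mcomposable h k) :
    mcomposable g (mmul hk) by [].
have minvKl g h (gh : mcomposable g h) : mcomposable (minv g) (mmul gh).
  by rewrite /mcomposable base_minv /= mshiftK.
have minvKr g h (gh : mcomposable g h) : mcomposable (mmul gh) (minv h).
  by rewrite /mcomposable base_mmul /= mshiftD addrC addrK.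
split=> /=.
- move=> g h; split=> [gh|sgh]; last first.
    by have := congr1 (fun k : G => (\val k).1) sgh.
  by apply: arrow_eq => /=; rewrite gh.
- move=> g; exists (mcomposable_minvr g); apply: arrow_eq => //=.
  by rewrite mshiftK.
- move=> g; exists (mcomposable_minvl g); apply: arrow_eq => //=.
  by rewrite base_minv opprK.
- by move=> g; apply: arrow_eq; rewrite /= base_minv mshiftK.
- move=> g h k gh hk; exists (mulA_l _ _ _ gh hk), (mulA_r _ _ _ gh hk).
  apply: arrow_eq => //; rewrite [LHS]/= base_mmul /=.
  by rewrite mshiftD opprD.
- move=> g h gh; exists (minvKl _ _ gh); apply: arrow_eq => /=; first by rewrite gh.
  by rewrite base_minv opprK mshiftNK.
- move=> g h gh; exists (minvKr _ _ gh); apply: arrow_eq => //=.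
  by rewrite base_mmul gh !mshiftD addrA (addrC (base h)) subrr mshift0.
Qed.

Lemma nbhs_arrowP g (A : set G) : nbhs g A <-> exists2 e, 0 < e &
  forall h, near_marked (\val g).1 e (\val h).1 ->
            near_marked (\val g).2 e (\val h).2 -> A h.
Proof.
split=> [/nbhs_set_typeP[B [[B1 B2] /= [nB1 nB2] B12] BA]|[e e0 eA]].
  have [e1 e10 sub1] := (nbhs_markedP _ _).1 nB1.
  have [e2 e20 sub2] := (nbhs_markedP _ _).1 nB2.
  have m0 : 0 < Num.min e1 e2 by rewrite lt_min e10.
  exists (Num.min e1 e2) => // h n1 n2; apply: BA; apply: B12; split => /=.
    by apply: sub1; apply: near_marked_le n1; rewrite // ge_min lexx.
  by apply: sub2; apply: near_marked_le n2; rewrite // ge_min lexx orbT.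
apply/nbhs_set_typeP.
exists (near_marked (\val g).1 e `*` near_marked (\val g).2 e).
  by exists (near_marked (\val g).1 e, near_marked (\val g).2 e) => //=;
    split; exact: near_markedW.
by move=> h [/= n1 n2]; exact: eA.
Qed.

Lemma continuous_arrow1 : continuous (fun g => (\val g).1).
Proof.
move=> g; apply: (@continuous_comp _ _ _ (fun h => \val h) fst); last exact: cvg_fst.
exact: continuous_set_val.
Qed.

Lemma continuous_arrow2 : continuous (fun g => (\val g).2).
Proof.
move=> g; apply: (@continuous_comp _ _ _ (fun h => \val h) snd); last exact: cvg_snd.
exact: continuous_set_val.
Qed.

Lemma continuous_to_arrow (X : topologicalType) (f : X -> G) :
  continuous (fun x => (\val (f x)).1) -> continuous (fun x => (\val (f x)).2) ->
  continuous f.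
Proof.
move=> c1 c2.
apply: (@continuous_comp_initial _ _ _ (fun g : G => \val g)).
rewrite (_ : _ \o f = fun x => ((\val (f x)).1, (\val (f x)).2)).
  exact: continuous_pair.
by apply/funext => y /=; rewrite -surjective_pairing.
Qed.

Lemma continuous_base : continuous (@base K d n r R L0).
Proof.
move=> g; apply: (@continuous_comp _ _ _ (fun h => (\val h).2) (fun xi => lab xi ord0)).
  exact: continuous_arrow2.
exact: continuous_lab.
Qed.

Lemma continuous_mshift_fun (X : topologicalType) (u : X -> 'rV[K]_d.+1)
    (f : X -> T) :
  continuous u -> continuous f -> continuous (fun x => mshift (u x) (f x)).
Proof.
move=> cu cf x.
apply: (@continuous_comp _ _ _ (fun x => (u x, f x)) (fun p => mshift p.1 p.2)).
  exact: continuous_pair.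
exact: continuous_mshift.
Qed.

Lemma continuous_minv : continuous (@minv K d n r R L0).
Proof.
apply: continuous_to_arrow; apply: continuous_mshift_fun.
- exact: continuous_base.
- exact: continuous_arrow2.
- exact: continuous_base.
- exact: continuous_arrow1.
Qed.

Lemma continuous_msource : continuous (@msource K d n r R L0).
Proof.
by apply: continuous_to_arrow; apply: continuous_mshift_fun;
  [exact: continuous_base|exact: continuous_arrow2
  |exact: continuous_base|exact: continuous_arrow2].
Qed.

Lemma continuous_mrange : continuous (@mrange K d n r R L0).
Proof. by apply: continuous_to_arrow; exact: continuous_arrow1. Qed.

Lemma continuous_gmul_pair : continuous (@gmul_pair G S).
Proof.
have c1 : continuous (fun p : composable_pairs S => (\val p).1).
  move=> p; apply: (@continuous_comp _ _ _
    (fun q : composable_pairs S => \val q) fst); last exact: cvg_fst.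
  exact: continuous_set_val.
have c2 : continuous (fun p : composable_pairs S => (\val p).2).
  move=> p; apply: (@continuous_comp _ _ _
    (fun q : composable_pairs S => \val q) snd); last exact: cvg_snd.
  exact: continuous_set_val.
apply: continuous_to_arrow => [p|].
  apply: (@continuous_comp _ _ _ (fun q : composable_pairs S => (\val q).1)
    (fun g => (\val g).1)); [exact: c1|exact: continuous_arrow1].
apply: continuous_mshift_fun => p; last first.
  apply: (@continuous_comp _ _ _ (fun q : composable_pairs S => (\val q).2)
    (fun g => (\val g).2)); [exact: c2|exact: continuous_arrow2].
apply: (@continuous_comp _ _ _ (fun q : composable_pairs S => base (\val q).1)
  (fun x : 'rV[K]_d.+1 => - x)); last exact: opp_continuous.
apply: (@continuous_comp _ _ _ (fun q : composable_pairs S => (\val q).1)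
  (@base K d n r R L0)); [exact: c1|exact: continuous_base].
Qed.

Lemma arrow_hausdorff : hausdorff_space G.
Proof.
move=> g h cl; apply: arrow_eq; apply: marked_hausdorff => A B nA nB.
  have [k [/= Ak Bk]] := cl _ _ (continuous_arrow1 nA) (continuous_arrow1 nB).
  by exists (\val k).1.
have [k [/= Ak Bk]] := cl _ _ (continuous_arrow2 nA) (continuous_arrow2 nB).
by exists (\val k).2.
Qed.

(** Bounding the labels is enough: the only way for a family of marked lattices
    not to accumulate is that some marked point escapes to infinity. *)
Lemma compact_bounded_arrows (M1 M2 : 'I_n.+1 -> K) : 0 < r < R ->
  compact [set g : G | forall i, enorm (lab (\val g).1 i) <= M1 i /\
                                 enorm (lab (\val g).2 i) <= M2 i].
Proof.
move=> rR; rewrite compact_ultra => F FU FB.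
have FP : ProperFilter F by exact: ultra_proper.
have [|xi latxi cvxi] :=
    marked_ultra_cvg (xi := fun g : G => (\val g).1) (M := M1) FU rR.
  by move=> j; apply: filterS FB => g /(_ j)[].
have [|zeta latzeta cvzeta] :=
    marked_ultra_cvg (xi := fun g : G => (\val g).2) (M := M2) FU rR.
  by move=> j; apply: filterS FB => g /(_ j)[].
have latE : lat xi = lat zeta.
  rewrite latxi latzeta; congr limit_lattice.
  by apply/funext => g; have [] := set_valP g.
have hullxi : hull L0 (lat xi).
  by rewrite latxi; apply: hull_limit_lattice => g; have [] := set_valP g.
have near_lim e : 0 < e -> \forall g \near F,
    near_marked xi e (\val g).1 /\ near_marked zeta e (\val g).2.
  move=> e0; have n1 : \forall g \near F, near_marked xi e (\val g).1.
    exact: cvxi _ (near_markedW xi e0).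
  have n2 : \forall g \near F, near_marked zeta e (\val g).2.
    exact: cvzeta _ (near_markedW zeta e0).
  by apply: filterS (filterI n1 n2).
have near_arrow e : 0 < e -> exists2 g : G,
    (forall i, enorm (lab (\val g).1 i) <= M1 i /\
               enorm (lab (\val g).2 i) <= M2 i) &
    near_marked xi e (\val g).1 /\ near_marked zeta e (\val g).2.
  by move=> /near_lim /(filterI FB) /filter_ex[g [Mg ng]]; exists g.
have xi0 : lab xi ord0 = 0.
  apply: enorm_eq => e /near_arrow[g _ [[_ _ /(_ ord0) +] _]].
  by have [_ _ ->] := set_valP g; rewrite enormB.
have arrow : marked_arrows L0 (xi, zeta) by [].
exists (SigSub (mem_set arrow)); split => /=.
  move=> i; split; apply/ler_addgt0Pr => e;
    move=> /near_arrow[g /(_ i)[M1g M2g] [[_ _ l1] [_ _ l2]]].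
    have := enorm_leB (lab xi i) (lab (\val g).1 i).
    by rewrite (enormB (lab xi i)); move: (l1 i); lra.
  have := enorm_leB (lab zeta i) (lab (\val g).2 i).
  by rewrite (enormB (lab zeta i)); move: (l2 i); lra.
move=> A /nbhs_arrowP[e /near_lim ne /= eA].
by apply: filterS ne => g [n1 n2]; exact: eA.
Qed.

Lemma arrow_locally_compact : 0 < r < R -> locally_compact [set: G].
Proof.
move=> rR g _.
pose M1 i := enorm (lab (\val g).1 i) + 1.
pose M2 i := enorm (lab (\val g).2 i) + 1.
pose B := [set h : G | forall i, enorm (lab (\val h).1 i) <= M1 i /\
                                 enorm (lab (\val h).2 i) <= M2 i].
have cB : compact B by exact: compact_bounded_arrows.
exists B; last by split=> //; exact: compact_closed arrow_hausdorff cB.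
suff : nbhs g B by apply: filterS => h Bh _.
apply/nbhs_arrowP; exists 1 => // h [_ _ l1] [_ _ l2] i; split.
  by have := enorm_leB (lab (\val h).1 i) (lab (\val g).1 i);
    move: (l1 i); rewrite /M1; lra.
by have := enorm_leB (lab (\val h).2 i) (lab (\val g).2 i);
  move: (l2 i); rewrite /M2; lra.
Qed.

Lemma marked_is_topological_groupoid : 0 < r < R -> is_topological_groupoid S.
Proof.
move=> rR; split.
- exact: marked_is_groupoid.
- exact: arrow_locally_compact.
- exact: arrow_hausdorff.
- exact: continuous_minv.
- exact: continuous_msource.
- exact: continuous_mrange.
- exact: continuous_gmul_pair.
Qed.

Lemma continuous_range_to_units : continuous (@range_to_units G S).
Proof.
apply: (@continuous_comp_initial _ _ _ (fun u : unit_space S => \val u)).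
exact: continuous_mrange.
Qed.

Lemma range_to_units_surj :
  set_surj [set: G] [set: unit_space S] (@range_to_units G S).
Proof.
move=> u _; have [g _ gu] := set_valP u; exists g => //.
by apply: val_inj.
Qed.

(** An arrow over [xi'] near [(\val g).1] is obtained by following the marked
    points of [(\val g).2] in the lattice of [xi']. *)
Lemma range_to_units_open g (A : set G) : nbhs g A ->
  nbhs (range_to_units S g) (range_to_units S @` A).
Proof.
move=> /nbhs_arrowP[e e0 eA]; have [latE _ _] := set_valP g.
have nF := near_marked_follow e0 latE.
apply/nbhs_set_typeP.
exists [set h | near_marked (\val g).1 e (\val h).1 /\
   exists2 zeta', lat zeta' = lat (\val h).1 & near_marked (\val g).2 e zeta'].
  have n1 : \forall h \near mrange g, near_marked (\val g).1 e (\val h).1.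
    exact: (@continuous_arrow1 (mrange g) _ (near_markedW (\val g).1 e0)).
  have n2 : \forall h \near mrange g, exists2 zeta',
      lat zeta' = lat (\val h).1 & near_marked (\val g).2 e zeta'.
    exact: (@continuous_arrow1 (mrange g) _ nF).
  exact: filterI n1 n2.
move=> u [/= n1 [zeta latz n2]]; have [h _ hu] := set_valP u.
have [latu hullu u0] := set_valP (\val u).
have arrow : marked_arrows L0 ((\val (\val u)).1, zeta) by split.
exists (SigSub (mem_set arrow)); first exact: eA.
by do 2 apply: val_inj; rewrite /= -hu.
Qed.

(** Arrows with the same range have the same lattice, in which two labels that
    are both closer than [r] to a label of [g] coincide. *)
Lemma range_to_units_locally_injective g : exists U : set G, [/\ open U, U g &
  forall h k, U h -> U k -> range_to_units S h = range_to_units S k -> h = k].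
Proof.
have [/andP[r0 _] _] := lat_delone (\val g).2.
pose V := [set h : G | forall i, enorm (lab (\val h).2 i - lab (\val g).2 i) < r].
have nV : nbhs g V by apply/nbhs_arrowP; exists r => // h _ [].
exists V°; split; [exact: open_interior|exact: nV|].
move=> h k /interior_subset Vh /interior_subset Vk.
move=> /(congr1 (fun u : unit_space S => (\val (\val u)).1)) /= e1.
apply: arrow_eq => //.
have [lath _ _] := set_valP h; have [latk _ _] := set_valP k.
have latE : lat (\val h).2 = lat (\val k).2 by rewrite -lath -latk e1.
apply: marked_delone_lab_eq => //; apply/funext => i.
apply: (delone_limit_separated (lat_delone (\val h).2)).
- exact: lab_lat.
- by rewrite latE; exact: lab_lat.
have := enorm_triangle (lab (\val g).2 i) (lab (\val h).2 i) (lab (\val k).2 i).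
by rewrite (enormB (lab (\val g).2 i)); move: (Vh i) (Vk i); lra.
Qed.

End marked_groupoid_theory.

Theorem proposition6p37 (K : realType) (d n : nat) (r R : K)
    (L0 : set 'rV[K]_d.+1) (hrR : 0 < r < R) (hL0 : is_delone r R L0) :
  is_etale_groupoid (marked_groupoid n r R L0).
Proof.
split.
- exact: marked_is_topological_groupoid.
- apply: local_homeomorphism_intro.
  + exact: continuous_range_to_units.
  + exact: range_to_units_open.
  + exact: range_to_units_locally_injective.
- exact: range_to_units_surj.
Qed.
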